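(* Two sets $S,T\subseteq\mathbb{F}_2^n$ are affinely equivalent if and only if there is a bijection $g:S\to T$ such that the induced map $g_*:\mathcal{P}(S)\to\mathcal{P}(T)$, $g_*(X)=g(X)$, restricts to a bijection from $E(S)$ onto $E(T)$.
   Context: $S,T$ are affinely equivalent if some affine automorphism $f$ of $\mathbb{F}_2^n$ satisfies $f(S)=T$. For $S\subseteq\mathbb{F}_2^n$, $E(S)$ is the collection of even zero-sum subsets of $S$: subsets of even cardinality whose elements sum to $\vec 0$, with $\varnothing\in E(S)$. *)

(* Defs.v *)
From mathcomp Require Import all_boot all_algebra.

Set Implicit Arguments.
Unset Strict Implicit.
Unset Printing Implicit Defensive.

Import GRing.Theory.
Local Open Scope ring_scope.

Definition affine_map (R : nzRingType) (U V : lmodType R) (f : U -> V) : Prop :=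
  exists (L : {linear U -> V}) (b : V), forall x, f x = L x + b.

Definition affine_automorphism (R : nzRingType) (V : lmodType R) (f : V -> V) :
  Prop := affine_map f /\ bijective f.

Definition affinely_equivalent (n : nat) (S T : {set 'rV['F_2]_n}) : Prop :=
  exists f : 'rV['F_2]_n -> 'rV['F_2]_n, affine_automorphism f /\ f @: S = T.

Definition even_zero_sum (n : nat) (S : {set 'rV['F_2]_n}) :
  {set {set 'rV['F_2]_n}} :=
  [set X in powerset S | ~~ odd #|X| & \sum_(x in X) x == 0].

(* A map A -> B is represented by a total function f, of which only the values
   on A matter. *)
Definition bijection_between (aT rT : finType) (A : {set aT}) (B : {set rT})
    (f : aT -> rT) : Prop :=
  {in A &, injective f} /\ f @: A = B.

Definition induced_map (aT rT : finType) (g : aT -> rT) (X : {set aT}) :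
  {set rT} := g @: X.

(* Main.v *)
Require Import Defs.
From mathcomp Require Import all_boot all_algebra.

(** Translating a point [s0] of [S] to the origin, a linear dependence among the
    vectors [x - s0], [x \in S], is a subset of [S], and since [s0 - s0 = 0] the
    point [s0] may be added or removed to make its cardinality even; it is then
    an element of [even_zero_sum S].  Hence [g] preserves even zero-sum sets in
    both directions iff [x - s0] and [g x - g s0] satisfy the same linear
    dependences.  Two matrices with the same left kernel differ by an invertible
    right factor, which is the linear part of the affine automorphism sought. *)

Set Implicit Arguments.
Unset Strict Implicit.
Unset Printing Implicit Defensive.

Import GRing.Theory.
Local Open Scope ring_scope.

(** The inclusion says that [cokermx A^T] annihilates [B^T]. After transposition its columns become
    rows [c] with [c *m A = 0], to which the hypothesis applies. *)
Lemma submx_tr_lker (F : fieldType) (m n p : nat)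
    (A : 'M[F]_(m, n)) (B : 'M[F]_(m, p)) :
  (forall c : 'rV_m, c *m A = 0 -> c *m B = 0) -> (B^T <= A^T)%MS.
Proof.
move=> kerAB; rewrite submxE -[_ *m _]trmxK trmx_mul trmxK trmx_eq0.
apply/eqP/row_matrixP=> i; rewrite row0 row_mul kerAB //.
rewrite -row_mul -[A in _ *m A]trmxK -trmx_mul.
by rewrite mulmx_coker trmx0 row0.
Qed.

(** Equal left kernels force equal column spaces, and matrices of the same shape with equal column
    spaces differ by invertible column operations. *)
Lemma eq_lker_mulmx_unit (F : fieldType) (m n : nat) (A B : 'M[F]_(m, n)) :
  (forall c : 'rV_m, c *m A = 0 <-> c *m B = 0) ->
  exists2 M, M \in unitmx & A *m M = B.
Proof.
move=> kerAB.
have /eqmxMunitP[U uU BU] : (B^T == A^T)%MS.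
  by apply/andP; split; apply: submx_tr_lker => c /kerAB.
exists U^T; first by rewrite unitmx_tr.
by rewrite -[RHS]trmxK BU trmx_mul trmxK.
Qed.

Lemma F2_eq01 (a : 'F_2) : a = if a == 0 then 0 else 1.
Proof. by apply/val_inj; case: a => -[|[|]]. Qed.

Lemma rV_F2_addvv (n : nat) (v : 'rV['F_2]_n) : v + v = 0.
Proof. by rewrite -mulr2n -scaler_nat pchar_Zp // scale0r. Qed.

Lemma rV_F2_mulrn (n k : nat) (v : 'rV['F_2]_n) : v *+ k = v *+ odd k.
Proof.
by rewrite -[in LHS](odd_double_half k) mulrnDr -muln2 mulnC mulrnA mulr2n
  rV_F2_addvv mul0rn addr0.
Qed.

(** Over ['F_2] a coefficient row is the indicator of a subset of [S], so sums over subsets account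
    for every linear dependence. *)
Lemma F2_same_dependences (I : finType) (n : nat) (S : {set I})
    (u v : I -> 'rV['F_2]_n) :
  (forall X : {set I}, X \subset S ->
     \sum_(x in X) u x = 0 <-> \sum_(x in X) v x = 0) ->
  exists2 M, M \in unitmx & {in S, forall x, u x *m M = v x}.
Proof.
move=> depuv.
pose A w : 'M['F_2]_(#|S|, n) := \matrix_i w (enum_val i : I).
have AE w (c : 'rV_#|S|) :
    c *m A w = \sum_(x in enum_val @: [set i | c 0 i != 0]) w x.
  rewrite mulmx_sum_row big_imset /=; last by move=> i j _ _ /enum_val_inj.
  rewrite [RHS]big_mkcond /=; apply: eq_bigr => i _.
  rewrite inE rowK [c 0 i]F2_eq01.
  by case: (c 0 i == 0); rewrite ?eqxx ?scale0r ?scale1r ?oner_eq0.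
have [c|M uM AM] := @eq_lker_mulmx_unit _ _ _ (A u) (A v).
  rewrite !AE; apply: depuv; apply/subsetP=> _ /imsetP[i _ ->].
  exact: enum_valP.
exists M => // x Sx; have /(congr1 (row (enum_rank_in Sx x))) := AM.
by rewrite row_mul !rowK enum_rankK_in.
Qed.

(** [Y] is chosen before [f], so that one set serves both [x - s] and [g x - g s]. *)
Lemma exists_even_same_sum (I : finType) (s : I) (X : {set I}) :
  exists Y : {set I}, [/\ Y \subset s |: X, ~~ odd #|Y| &
    forall (V : nmodType) (f : I -> V), f s = 0 ->
      \sum_(x in Y) f x = \sum_(x in X) f x].
Proof.
have [oddX|evenX] := boolP (odd #|X|); last first.
  by exists X; split=> //; apply: subsetUr.
have [Xs|X's] := boolP (s \in X).
  exists (X :\ s); split=> [||V f fs0].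
  - exact: subset_trans (subsetDl _ _) (subsetUr _ _).
  - by move: oddX; rewrite (cardsD1 s) Xs.
  - by rewrite [RHS](big_setD1 s) //= fs0 add0r.
exists (s |: X); split=> [||V f fs0] //.
- by rewrite cardsU1 X's /= oddX.
- by rewrite big_setU1 //= fs0 add0r.
Qed.

Lemma sum_even_translate (I : finType) (n : nat) (X : {set I})
    (f : I -> 'rV['F_2]_n) (b : 'rV['F_2]_n) :
  ~~ odd #|X| -> \sum_(x in X) (f x + b) = \sum_(x in X) f x.
Proof.
move=> evenX; rewrite big_split /= sumr_const rV_F2_mulrn (negPf evenX).
by rewrite addr0.
Qed.

Section EvenZeroSum.

Variable n : nat.
Implicit Types (S T X : {set 'rV['F_2]_n}) (f g : 'rV['F_2]_n -> 'rV['F_2]_n).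

Lemma mem_even_zero_sum S X :
  (X \in even_zero_sum S)
    = [&& X \subset S, ~~ odd #|X| & \sum_(x in X) x == 0].
Proof. by rewrite inE powersetE. Qed.

(** On an even set the constant part of [f] cancels from the sum, and the linear part, injective
    like [f], reflects zero. *)
Lemma affine_even_zero_sum f S X :
  affine_automorphism f ->
  (f @: X \in even_zero_sum (f @: S)) = (X \in even_zero_sum S).
Proof.
case=> -[L [b fE]] bij_f; have inj_f := bij_inj bij_f.
have inj_L : injective L.
  by move=> x y Lxy; apply: inj_f; rewrite !fE Lxy.
rewrite !mem_even_zero_sum card_imset // big_imset /=; last exact: in2W.
have -> : (f @: X \subset f @: S) = (X \subset S).
  apply/idP/idP=> [sfXS|]; last exact: imsetS.
  apply/subsetP=> x Xx; rewrite -(mem_imset S x inj_f).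
  by apply: (subsetP sfXS); rewrite imset_f.
case: (X \subset S) => //=; case: (boolP (odd #|X|)) => //= evenX.
under eq_bigr do rewrite fE.
by rewrite sum_even_translate // -raddf_sum raddf_eq0.
Qed.

Lemma bijection_even_zero_sum g S T X :
  bijection_between S T g ->
  bijection_between (even_zero_sum S) (even_zero_sum T) (induced_map g) ->
  X \subset S -> (g @: X \in even_zero_sum T) = (X \in even_zero_sum S).
Proof.
move=> [inj_g _] [_ <-] sXS; apply/imsetP/idP=> [[Y EY gXY]|EX]; last by exists X.
(* [g] is injective only on [S], so [X = Y] follows from [g @: X = g @: Y] because both sets lie in
   [S]. *)
suff -> : X = Y by [].
have sYS : Y \subset S by move: EY; rewrite mem_even_zero_sum => /andP[].
have sub (A B : {set 'rV['F_2]_n}) :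
    A \subset S -> B \subset S -> g @: A = g @: B -> A \subset B.
  move=> sAS sBS gAB; apply/subsetP=> x Ax.
  have : g x \in g @: B by rewrite -gAB imset_f.
  by case/imsetP=> y By /inj_g -> //; [apply: (subsetP sAS)|apply: (subsetP sBS)].
by apply/eqP; rewrite eqEsubset; apply/andP; split; apply: sub.
Qed.

Lemma bijection_same_dependences g S T s X :
  bijection_between S T g ->
  bijection_between (even_zero_sum S) (even_zero_sum T) (induced_map g) ->
  s \in S -> X \subset S ->
  \sum_(x in X) (x - s) = 0 <-> \sum_(x in X) (g x - g s) = 0.
Proof.
move=> bij_g bij_E Ss sXS.
have [Y [sYX evenY sumY]] := exists_even_same_sum s X.
have sYS : Y \subset S by rewrite (subset_trans sYX) // subUset sub1set Ss.
(* Both summands vanish at [s], so both sums pass to [Y], where evenness removes the shifts by [s]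
   and [g s]. *)
rewrite -!sumY ?subrr // !sum_even_translate //.
have := bijection_even_zero_sum bij_g bij_E sYS.
have [inj_g gST] := bij_g.
have inj_gY : {in Y &, injective g}.
  by move=> x y Yx Yy; apply: inj_g; apply: (subsetP sYS).
rewrite !mem_even_zero_sum sYS evenY -gST imsetS // card_in_imset // evenY /=.
by rewrite big_imset //= => EE; split=> /eqP; [rewrite -EE|rewrite EE] => /eqP.
Qed.

End EvenZeroSum.

Theorem theorem2p6 (n : nat) (S T : {set 'rV['F_2]_n}) :
  affinely_equivalent S T <->
  exists g : 'rV['F_2]_n -> 'rV['F_2]_n,
    bijection_between S T g /\
    bijection_between (even_zero_sum S) (even_zero_sum T) (induced_map g).
Proof.
split=> [[f [aff_f <-]]|[g [bij_g bij_E]]].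
  have inj_f := bij_inj aff_f.2; exists f; split; split=> //; first exact: in2W.
    by move=> X Y _ _; apply: imset_inj.
  apply/setP=> Y; apply/imsetP/idP=> [[X EX ->]|EY].
    by rewrite affine_even_zero_sum.
  have [h _ hK] := aff_f.2.
  have YE : Y = f @: (h @: Y) by rewrite -imset_comp (eq_imset _ hK) imset_id.
  by exists (h @: Y) => //; rewrite -(affine_even_zero_sum S _ aff_f) -YE.
(* An empty [S] offers no base point, but then [T] is empty too and the identity works. *)
have [S0|[s Ss]] := set_0Vmem S.
  exists id; split; last by rewrite -bij_g.2 S0 !imset0.
  split; last by exists id.
  by exists idfun, 0 => x; rewrite addr0.
have [X sXS|M uM gM] :=
    @F2_same_dependences _ _ S (fun x => x - s) (fun x => g x - g s).
  exact: bijection_same_dependences bij_g bij_E Ss sXS.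
exists (fun x => (x - s) *m M + g s); split.
  split.
    by exists (mulmxr M), (g s - s *m M) => x; rewrite /= mulmxBl addrAC addrA.
  exists (fun y => (y - g s) *m invmx M + s) => x.
    by rewrite addrK mulmxK // subrK.
  by rewrite addrK mulmxKV // subrK.
rewrite -bij_g.2; apply: eq_in_imset => x Sx.
by rewrite gM // subrK.
Qed.
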